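(* Let $K,L\in\mathbb{R}^{l\times l}$ be constant skew-symmetric matrices, let $L_+\in\mathbb{R}^{l\times l}$ satisfy $L=L_+-L_+^T$, and let $S:\mathbb{R}^l\to\mathbb{R}$ be a polynomial of degree at most three with polarised function $\bar S$. Let $z_j^n\in\mathbb{R}^l$ be a grid function satisfying, for all $n\ge 0$ and $j=0,\ldots,M-1$, the linearly implicit local energy-preserving (LILEP) scheme $$K\delta_{t}\mu_{x}z_j^n+L\delta_x \mu_{t}z_j^n= 3\,\partial_1\bar{S}(\mu_x z_j^n,\mu_x z_j^{n+1}).$$ Then for all $n\ge 0$ and $j=0,\dots,M-1$ it satisfies the discrete local energy conservation law $$\delta_{t} (\bar{E}_L)_{j}^n +\delta_{x}(\bar{F}_L)_j^{n}=0,$$ where $$(\bar{E}_L)_{j}^n=\bar{S}(\mu_x z_j^n, \mu_x z_j^n, \mu_x z_j^{n+1})+\tfrac{1}{3}(\delta_{x}z_j^n)^TL_+\mu_x z_j^n+\tfrac{1}{3}(\delta_{x}z_j^n)^TL_+\mu_x z_j^{n+1}+\tfrac{1}{3}(\delta_{x}z_j^{n+1})^TL_+\mu_x z_j^{n},$$ $$(\bar{F}_L)_j^{n}=-\tfrac{1}{3}(\delta_{t}z_j^n)^TL_+\mu_t z_j^{n} - \tfrac{1}{3}(\delta_{t}z_j^n)^TL_+\mu_t z_j^{n+1} - \tfrac{1}{3}(\delta_{t}z_j^{n+1})^TL_+\mu_{t}z_j^n.$$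
   Context: The scheme discretizes the multi-symplectic PDE $Kz_t+Lz_x=\nabla S(z)$, $z(x,t)\in\mathbb{R}^l$, on a uniform grid with spatial step $\Delta x>0$ and time step $\Delta t>0$; $z_j^n$ is the value at spatial index $j$ and time level $n$. Difference and averaging operators on (scalar- or vector-valued) grid functions $v_j^n$: $$\delta_t v_j^n=\frac{v_j^{n+1}-v_j^n}{\Delta t},\quad \delta_x v_j^n=\frac{v_{j+1}^n-v_j^n}{\Delta x},\quad \mu_t v_j^n=\frac{v_j^{n+1}+v_j^n}{2},\quad \mu_x v_j^n=\frac{v_{j+1}^n+v_j^n}{2}.$$ Polarisation: $S$ is written $S(y)=y^TQ(y)y+y^TBy+c^Ty+d$, where $Q(y)$ is the symmetric matrix, with entries homogeneous linear in $y$, equal to $\frac16$ times the homogeneous linear part of the Hessian $\nabla^2S(y)$, $B$ is the constant symmetric matrix equal to $\frac12$ times the constant part of $\nabla^2 S(y)$, $c\in\mathbb{R}^l$ and $d\in\mathbb{R}$. The polarised function $\bar S:\mathbb{R}^l\times\mathbb{R}^l\times\mathbb{R}^l\to\mathbb{R}$ is $$\bar S(\xi,y,w)=\xi^TQ(y)w+\tfrac13(\xi^TBy+y^TBw+w^TB\xi)+\tfrac13c^T(\xi+y+w)+d,$$ which is symmetric in its three arguments with $\bar S(y,y,y)=S(y)$. The notation $\partial_1\bar S(y,w)$ means the gradient of $\bar S$ with respect to its first argument (which does not depend on that argument), with second and third arguments $y,w$: $\partial_1\bar S(y,w)=Q(y)w+\tfrac13B(y+w)+\tfrac13c$. *)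

(* Defs.v *)
From mathcomp Require Import all_boot all_order all_algebra.
From mathcomp Require Import reals mpoly.
Set Implicit Arguments.
Unset Strict Implicit.
Unset Printing Implicit Defensive.
Import Order.TTheory GRing.Theory Num.Theory.
Local Open Scope ring_scope.

(* A grid function v_j^n is v : nat -> nat -> V, with the spatial index j first
   and the time level n second. *)
Section Grid.
Variables (R : realType) (V : lmodType R).
Implicit Types v : nat -> nat -> V.

Definition delta_t (dt : R) v (j n : nat) : V := dt^-1 *: (v j n.+1 - v j n).
Definition delta_x (dx : R) v (j n : nat) : V := dx^-1 *: (v j.+1 n - v j n).
Definition mu_t v (j n : nat) : V := 2^-1 *: (v j n.+1 + v j n).
Definition mu_x v (j n : nat) : V := 2^-1 *: (v j.+1 n + v j n).

End Grid.

Definition bilin (R : realType) (l : nat) (u : 'cV[R]_l) (A : 'M[R]_l)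
    (v : 'cV[R]_l) : R := (u^T *m A *m v) 0 0.

Section Polarisation.
Variables (R : realType) (l : nat) (S : {mpoly R[l]}).
Implicit Types xi y w : 'cV[R]_l.

(* S is a real polynomial, written S(y) = y^T Q(y) y + y^T B y + c^T y + d when
   its degree is at most three, i.e. msize S <= 4: Q(y) is 1/6 of the homogeneous
   linear part of the Hessian and B is 1/2 of its constant part. *)
Definition hess (i j : 'I_l) : {mpoly R[l]} := (S^`M(i))^`M(j).

(* [pihomog mdeg 1] projects a polynomial onto its degree-one homogeneous part. *)
Definition polQ y : 'M[R]_l :=
  \matrix_(i, j) (6^-1 * (pihomog mdeg 1 (hess i j)).@[fun k => y k 0]).

Definition polB : 'M[R]_l := \matrix_(i, j) (2^-1 * (hess i j)@_0%MM).

Definition polc : 'cV[R]_l := \col_i S@_U_(i)%MM.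

Definition pold : R := S@_0%MM.

Definition polS xi y w : R :=
  bilin xi (polQ y) w
  + 3^-1 * (bilin xi polB y + bilin y polB w + bilin w polB xi)
  + 3^-1 * (polc^T *m (xi + y + w)) 0 0
  + pold.

(* The gradient of polS S xi y w in xi; polS is affine in xi, so it does not
   depend on xi. *)
Definition d1polS y w : 'cV[R]_l :=
  polQ y *m w + 3^-1 *: (polB *m (y + w)) + 3^-1 *: polc.

End Polarisation.

Section Scheme.
Variables (R : realType) (l : nat).
Implicit Types (z : nat -> nat -> 'cV[R]_l) (Lp : 'M[R]_l).

(* [R^o] is [R] viewed as a module over itself, so that [delta_t] applies. *)
Definition energyL (dx : R) Lp (S : {mpoly R[l]}) z (j n : nat) : R^o :=
  polS S (mu_x z j n) (mu_x z j n) (mu_x z j n.+1)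
  + 3^-1 * bilin (delta_x dx z j n) Lp (mu_x z j n)
  + 3^-1 * bilin (delta_x dx z j n) Lp (mu_x z j n.+1)
  + 3^-1 * bilin (delta_x dx z j n.+1) Lp (mu_x z j n).

Definition fluxL (dt : R) Lp z (j n : nat) : R^o :=
  - (3^-1 * bilin (delta_t dt z j n) Lp (mu_t z j n))
  - 3^-1 * bilin (delta_t dt z j n) Lp (mu_t z j n.+1)
  - 3^-1 * bilin (delta_t dt z j n.+1) Lp (mu_t z j n).

End Scheme.

(* Main.v *)
Require Import Defs.
From mathcomp Require Import all_boot all_order all_algebra.
From mathcomp Require Import reals mpoly.
From mathcomp Require Import ring lra.
Set Implicit Arguments.
Unset Strict Implicit.
Unset Printing Implicit Defensive.
Import Order.TTheory GRing.Theory Num.Theory.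
Local Open Scope ring_scope.

(** Write [a n] for [delta_t (mu_x z)] and [b n] for [delta_x (mu_t z)] at
    time level [n], so that the scheme reads
    [K (a n) + L (b n) = 3 d1polS (m n) (m n.+1)] with [m n := mu_x z] at
    level [n].

    The polarised function is symmetric and affine in each argument, so the
    increment of [polS (m n) (m n) (m n.+1)] over a time step splits through
    the intermediate value [polS (m n) (m n.+1) (m n.+2)] into two
    increments of a single argument ([polS_increment]):
    - [m n] moves to [m n.+1] against the gradient at
      [(m n.+1, m n.+2)];
    - [m n] moves to [m n.+2] against the gradient at [(m n, m n.+1)].
    Divided by the time step, these displacements are [a n] and
    [a n + a n.+1], while the gradients are given by the scheme at levels
    [n.+1] and [n].  Since [K] is skew, all terms in [K] cancel and what is
    left is [3^-1] times the sum of [a^T L b] over the pairs of levels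
    [(n, n)], [(n, n.+1)] and [(n.+1, n)].

    Each of the three quadratic terms of the energy is paired with a term of
    the flux, and belongs to one of these pairs of levels.  Differences and
    averages commute, and the identity [delta_pair_exchange] turns
    each energy-flux pair into [- (a^T Lp b' - b^T Lp a')].  Added up
    over the three pairs of levels, a set stable under exchange, this is
    minus the previous sum, because [L = Lp - Lp^T]. *)

(** * Bilinear forms *)

Section Bilinear.
Variables (R : realType) (l : nat).
Implicit Types (u v w : 'cV[R]_l) (A B : 'M[R]_l) (a : R).

Lemma bilinDl u v A w : bilin (u + v) A w = bilin u A w + bilin v A w.
Proof. by rewrite /bilin linearD /= !mulmxDl mxE. Qed.

Lemma bilinDr u A v w : bilin u A (v + w) = bilin u A v + bilin u A w.
Proof. by rewrite /bilin mulmxDr mxE. Qed.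

Lemma bilinZl a u A w : bilin (a *: u) A w = a * bilin u A w.
Proof. by rewrite /bilin linearZ /= -!scalemxAl mxE. Qed.

Lemma bilinZr a u A w : bilin u A (a *: w) = a * bilin u A w.
Proof. by rewrite /bilin -scalemxAr mxE. Qed.

Lemma bilinNl u A w : bilin (- u) A w = - bilin u A w.
Proof. by rewrite -scaleN1r bilinZl mulN1r. Qed.

Lemma bilinNr u A w : bilin u A (- w) = - bilin u A w.
Proof. by rewrite -scaleN1r bilinZr mulN1r. Qed.

Definition bilinE := (bilinDl, bilinDr, bilinNl, bilinNr, bilinZl, bilinZr).

Lemma bilin_tr u A w : bilin u A^T w = bilin w A u.
Proof.
have -> : bilin w A u = ((w^T *m A *m u)^T) 0 0 by rewrite mxE.
by rewrite /bilin !trmx_mul trmxK mulmxA.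
Qed.

Lemma bilinB_mx u A B w : bilin u (A - B) w = bilin u A w - bilin u B w.
Proof. by rewrite /bilin mulmxBr mulmxBl !mxE. Qed.

Lemma bilin_skew u A w : A^T = - A -> bilin u A w = - bilin w A u.
Proof. by move=> skA; rewrite -bilin_tr skA /bilin mulmxN mulNmx mxE. Qed.

Lemma bilin_skew_diag u A : A^T = - A -> bilin u A u = 0.
Proof. by move/(bilin_skew u u) => h; lra. Qed.

Lemma bilin_sum u A w :
  bilin u A w = \sum_i \sum_j u i 0 * A i j * w j 0.
Proof.
rewrite /bilin mxE exchange_big /=; apply: eq_bigr => j _.
by rewrite mxE mulr_suml; apply: eq_bigr => i _; rewrite mxE.
Qed.

End Bilinear.

(** * Symmetry of the polarised function *)

(** Monomials of degree one are the variables, so the homogeneous part of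
    degree one is read off the coefficients at [U_(k)]. *)
Lemma meval_pihomog1 (R : realType) l (p : {mpoly R[l]}) (v : 'I_l -> R) :
  (pihomog mdeg 1 p).@[v] = \sum_k p@_U_(k) * v k.
Proof.
elim/mpolyind: p => [|c m p _ _ IHp].
  by rewrite pihomog0 meval0 big1 // => k _; rewrite mcoeff0 mul0r.
under eq_bigr do rewrite mcoeffD mcoeffZ mulrDl.
rewrite pihomogD linearZ /= mevalD mevalZ IHp big_split /=; congr (_ + _).
rewrite pihomogX; case: (mdeg1P m) => [[i /eqP ->]|not_var].
  rewrite mevalXU (bigD1 i) //= mcoeffX eqxx mulr1 big1 ?addr0 // => k ki.
  by rewrite mcoeffXU eq_sym (negbTE ki) mulr0 mul0r.
rewrite meval0 mulr0 big1 // => k _; rewrite mcoeffX.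
by case: eqP => [mk|]; [case: not_var; exists k; apply/eqP | rewrite mulr0 mul0r].
Qed.

Section Symmetry.
Variables (R : realType) (l : nat) (S : {mpoly R[l]}).
Implicit Types x y w : 'cV[R]_l.

(** Up to the factor [6^-1], these are the coefficients of the trilinear
    form [bilin x (polQ S y) w], which is symmetric because mixed partial
    derivatives commute. *)
Definition third_deriv0 (i j k : 'I_l) : R := ((hess S i j)^`M(k))@_0%MM.

Lemma polQ_sum x y w :
  bilin x (polQ S y) w =
  \sum_i \sum_j \sum_k 6^-1 * third_deriv0 i j k * (x i 0 * w j 0 * y k 0).
Proof.
rewrite bilin_sum; apply: eq_bigr => i _; apply: eq_bigr => j _.
rewrite mxE meval_pihomog1 mulr_sumr mulr_sumr mulr_suml.
apply: eq_bigr => k _.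
rewrite /third_deriv0 mcoeff_mderiv add0m mnm0E mulr1n; by field.
Qed.

Lemma polQ_swap x y w : bilin x (polQ S y) w = bilin w (polQ S y) x.
Proof.
rewrite !polQ_sum exchange_big /=; apply: eq_bigr => i _; apply: eq_bigr => j _.
apply: eq_bigr => k _; rewrite /third_deriv0 /hess (mderiv_comm i j); by field.
Qed.

Lemma polQ_swap_mid x y w : bilin x (polQ S y) w = bilin x (polQ S w) y.
Proof.
rewrite !polQ_sum; apply: eq_bigr => i _; rewrite exchange_big /=.
apply: eq_bigr => j _; apply: eq_bigr => k _.
rewrite /third_deriv0 /hess (mderiv_comm j k); by field.
Qed.

Lemma polB_sym x y : bilin x (polB S) y = bilin y (polB S) x.
Proof.
rewrite -bilin_tr; congr bilin; apply/matrixP => i j.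
by rewrite !mxE /hess mderiv_comm.
Qed.

Lemma polS_swap12 x y w : polS S x y w = polS S y x w.
Proof.
rewrite /polS (polQ_swap x) (polQ_swap_mid w) (polQ_swap w) (addrC y x).
rewrite (polB_sym x y) (polB_sym y w) (polB_sym w x); by field.
Qed.

Lemma polS_swap23 x y w : polS S x y w = polS S x w y.
Proof.
rewrite /polS polQ_swap_mid (addrAC x y w).
rewrite (polB_sym x y) (polB_sym y w) (polB_sym w x); by field.
Qed.

(** The gradient is constant in the first argument, so no remainder appears. *)
Lemma polS_diff x x' y w :
  polS S x y w - polS S x' y w = ((x - x')^T *m d1polS S y w) 0 0.
Proof.
have dotE u v : (u^T *m v) 0 0 = bilin u 1%:M v by rewrite /bilin mulmx1.
have -> : ((x - x')^T *m d1polS S y w) 0 0 =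
    bilin (x - x') (polQ S y) w
    + 3^-1 * bilin (x - x') (polB S) (y + w)
    + 3^-1 * bilin (x - x') 1%:M (polc S).
  rewrite /d1polS !mulmxDr -!scalemxAr [LHS]mxE [X in X + _]mxE.
  congr (_ + _ + _); first by rewrite /bilin mulmxA.
    by rewrite mxE -!mulmxDr /bilin !mulmxA.
  by rewrite mxE -dotE.
have polc_sym v : bilin (polc S) 1%:M v = bilin v 1%:M (polc S).
  by rewrite -bilin_tr trmx1.
rewrite /polS (polB_sym w x) (polB_sym w x') !dotE !polc_sym !bilinE.
by field.
Qed.

(** Neighbouring values [polS u u v] and [polS v v w] share only one
    argument, but each of them shares two with [polS u v w]. *)
Lemma polS_increment u v w :
  polS S v v w - polS S u u v =
  ((v - u)^T *m d1polS S v w) 0 0 + ((w - u)^T *m d1polS S u v) 0 0.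
Proof.
rewrite -!polS_diff.
have -> : polS S w u v = polS S u v w by rewrite polS_swap12 polS_swap23.
by field.
Qed.

End Symmetry.

(** * The exchange identity for energy-flux pairs *)

Section Exchange.
Variables (R : realType) (l : nat) (dt dx : R) (A : 'M[R]_l).
Implicit Types u w : nat -> nat -> 'cV[R]_l.

(** Two grid functions are used so that the terms of the energy and of the
    flux that mix two time levels are the cases where one of them is shifted
    in time. *)
Definition energy_pair u w (j n : nat) : R^o :=
  bilin (delta_x dx u j n) A (mu_x w j n).

Definition flux_pair u w (j n : nat) : R^o :=
  bilin (delta_t dt u j n) A (mu_t w j n).

(** The discrete counterpart of
    [d_t (u_x^T A w) - d_x (u_t^T A w) = u_x^T A w_t - u_t^T A w_x]: in the
    continuous case the mixed derivatives of [u] cancel, and here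
    differences and averages over the four corners of a cell commute. *)
Lemma delta_pair_exchange u w j n :
  delta_t dt (energy_pair u w) j n - delta_x dx (flux_pair u w) j n
  = bilin (delta_x dx (mu_t u) j n) A (delta_t dt (mu_x w) j n)
    - bilin (delta_t dt (mu_x u) j n) A (delta_x dx (mu_t w) j n).
Proof.
rewrite /energy_pair /flux_pair /delta_t /delta_x /mu_t /mu_x.
have scaleE (a : R) (r : R^o) : a *: r = a * r by [].
rewrite !scaleE !bilinE.
by move: dx^-1 dt^-1 => X T; field.
Qed.

End Exchange.

Theorem theorem1 (R : realType) (l M : nat) (dx dt : R)
    (K L Lp : 'M[R]_l) (S : {mpoly R[l]}) (z : nat -> nat -> 'cV[R]_l)
    (dx_gt0 : 0 < dx) (dt_gt0 : 0 < dt)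
    (K_skew : K^T = - K) (L_skew : L^T = - L) (L_split : L = Lp - Lp^T)
    (S_cubic : (msize S <= 4)%N)
    (scheme : forall n j : nat, (j < M)%N ->
       K *m delta_t dt (mu_x z) j n + L *m delta_x dx (mu_t z) j n
       = 3 *: d1polS S (mu_x z j n) (mu_x z j n.+1)) :
  forall n j : nat, (j < M)%N ->
    delta_t dt (energyL dx Lp S z) j n + delta_x dx (fluxL dt Lp z) j n = 0.
Proof.
move=> n j jM.
pose zs i k := z i k.+1.
pose a n := delta_t dt (mu_x z) j n.
pose b n := delta_x dx (mu_t z) j n.
have grad v k : (v^T *m d1polS S (mu_x z j k) (mu_x z j k.+1)) 0 0
    = 3^-1 * (bilin v K (a k) + bilin v L (b k)).
  have -> : d1polS S (mu_x z j k) (mu_x z j k.+1)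
      = 3^-1 *: (K *m a k + L *m b k).
    by rewrite scheme // scalerA mulVf ?scale1r // pnatr_eq0.
  by rewrite -scalemxAr mxE mulmxDr mxE /bilin !mulmxA.
(* The terms in [K] cancel: [a^T K a = 0] at level [n], and the two cross
   terms between levels [n] and [n.+1] are opposite. *)
have dS : dt^-1 * (polS S (mu_x z j n.+1) (mu_x z j n.+1) (mu_x z j n.+2)
                   - polS S (mu_x z j n) (mu_x z j n) (mu_x z j n.+1))
    = 3^-1 * (bilin (a n) L (b n) + bilin (a n) L (b n.+1)
              + bilin (a n.+1) L (b n)).
  have scale v k : dt^-1 * (v^T *m d1polS S (mu_x z j k) (mu_x z j k.+1)) 0 0
      = 3^-1 * (bilin (dt^-1 *: v) K (a k) + bilin (dt^-1 *: v) L (b k)).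
    by rewrite grad !bilinZl; ring.
  rewrite polS_increment mulrDr !scale.
  have -> : dt^-1 *: (mu_x z j n.+1 - mu_x z j n) = a n by [].
  have -> : dt^-1 *: (mu_x z j n.+2 - mu_x z j n) = a n + a n.+1.
    by rewrite -scalerDr [in RHS]addrC addrA subrK.
  rewrite !bilinDl (bilin_skew_diag (a n) K_skew).
  rewrite (bilin_skew (a n) (a n.+1) K_skew); ring.
have bilinL v w : bilin v L w = bilin v Lp w - bilin w Lp v.
  by rewrite L_split bilinB_mx bilin_tr.
rewrite !bilinL in dS.
have azs : delta_t dt (mu_x zs) j n = a n.+1 by [].
have bzs : delta_x dx (mu_t zs) j n = b n.+1 by [].
have energyE k : energyL dx Lp S z j k
    = polS S (mu_x z j k) (mu_x z j k) (mu_x z j k.+1)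
      + 3^-1 * energy_pair dx Lp z z j k + 3^-1 * energy_pair dx Lp z zs j k
      + 3^-1 * energy_pair dx Lp zs z j k by [].
have fluxE i : fluxL dt Lp z i n
    = - (3^-1 * flux_pair dt Lp z z i n) - 3^-1 * flux_pair dt Lp z zs i n
      - 3^-1 * flux_pair dt Lp zs z i n by [].
have exchange u w := delta_pair_exchange dt dx Lp u w j n.
have := exchange z z; have := exchange z zs; have := exchange zs z.
rewrite azs bzs -/(a n) -/(b n) /delta_t /delta_x !energyE !fluxE.
have scaleE (r : R) (s : R^o) : r *: s = r * s by [].
rewrite !scaleE => h10 h01 h00.
lra.
Qed.
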